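(* Assume that there is a constant $c_g$ with $1\le c_g\le 4$ such that $$(\widehat A_kv,v)\le(\widehat G_kv,v)\le c_g(\widehat A_kv,v)\qquad\text{for all } v\in\mathbb R^{2^k}\text{ and } k=2,\dots,J.$$ Let $B_J^{-1}$ be the AMLI preconditioner built with the polynomials $q_k(t)=q(t;\theta_k)$ (defined in the context from $c_g$). Then $$\rho\big((I-\Pi_{\mathbf 1})(I-B_J^{-1}A)\big)\le\min\left\{\frac{2\sqrt{c_g}-2}{\sqrt{c_g}},\ \frac{2J+\ln J}{2J+\ln J+1}\right\}<1,$$ where $\rho$ is the spectral radius and $\Pi_{\mathbf 1}$ is the $\ell_2$-orthogonal projection onto the space of constant vectors.
   Context: $(\cdot,\cdot)$ is the Euclidean inner product, $\mathbf 1$ the all-ones vector, $^\dagger$ the Moore–Penrose pseudo-inverse. The graph Laplacian $A$ of an unweighted graph $(\mathcal V,\mathcal E)$ is given by $(Au,v)=\sum_{(i,j)\in\mathcal E}(u_i-u_j)(v_i-v_j)$. Hierarchy: let $\mathcal G_J$ be a connected unweighted graph with $2^J$ vertices and graph Laplacian $A=A_J$. For $k=J,J-1,\dots,2$ let $\mathcal M_k$ be a perfect matching of $\mathcal G_k$ (which has $2^k$ vertices), and let $\mathcal G_{k-1}$ be the unweighted graph whose vertices are the edges of $\mathcal M_k$, two of them adjacent iff some edge of $\mathcal G_k$ joins a vertex of one to a vertex of the other. $A_k$ is the graph Laplacian of $\mathcal G_k$, $k=1,\dots,J$. For $k=2,\dots,J$, $P_k$ and $Y_k$ are the $2^k\times2^{k-1}$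 matrices whose columns, indexed by the edges $(i,j)\in\mathcal M_k$, are $e_i+e_j$ and $e_i-e_j$, respectively. $(Y_k,P_k)$ is the square matrix with these blocks. Let $\sigma>0$ be a fixed scaling constant and define for $k=2,\dots,J$ $$\widehat A_k=(Y_k,P_k)^TA_k(Y_k,P_k),\quad L_k=\begin{pmatrix}I&0\\P_k^TA_kY_k(Y_k^TA_kY_k)^{-1}&I\end{pmatrix},\quad \widehat G_k=L_k\begin{pmatrix}Y_k^TA_kY_k&0\\0&\sigma A_{k-1}\end{pmatrix}L_k^T.$$ AMLI preconditioner (the symbols $B_k^{-1},\widehat B_k^{-1}$ denote the matrices defined here; they are singular): $B_1^{-1}=A_1^\dagger$ and, for $k=2,\dots,J$, $$\widehat B_k^{-1}=L_k^{-T}\begin{pmatrix}(Y_k^TA_kY_k)^{-1}&0\\0&\sigma^{-1}B_{k-1}^{-1}q_{k-1}(A_{k-1}B_{k-1}^{-1})\end{pmatrix}L_k^{-1},\qquad B_k^{-1}=(Y_k,P_k)\widehat B_k^{-1}(Y_k,P_k)^T.$$ Polynomials: $q(t;\theta)=\frac{4}{\theta+1}\big(1-\frac{t}{\theta+1}\big)$, $q_k(t)=q(t;\theta_k)$, where $\theta_1=1$ and $\theta_{k+1}=\frac1{c_g}q(1;\theta_k)$. *)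

(* Defs.v *)
From HB Require Import structures.
From mathcomp Require Import all_boot all_order all_algebra.
From mathcomp Require Import boolp classical_sets reals exp.
From mathcomp Require Import complex.

Set Implicit Arguments.
Unset Strict Implicit.
Unset Printing Implicit Defensive.

Import Order.TTheory GRing.Theory Num.Theory.

Local Open Scope ring_scope.

Section LinearAlgebra.
Variable R : realType.

Definition evec n (i : 'I_n) : 'cV[R]_n := delta_mx i 0.

Definition ones n : 'cV[R]_n := const_mx 1.

Definition dotv n (u v : 'cV[R]_n) : R := \sum_i u i 0 * v i 0.

(* The four Penrose equations. *)
Definition is_pinv m n (A : 'M[R]_(m, n)) (X : 'M[R]_(n, m)) : Prop :=
  [/\ A *m X *m A = A, X *m A *m X = X,
      (A *m X)^T = A *m X & (X *m A)^T = X *m A].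

(* Moore-Penrose pseudo-inverse, well defined by [mp_pinvP] and
   [is_pinv_uniq]; mathcomp's [pinvmx] is only a one-sided inverse on the row
   space. *)
Definition mp_pinv m n (A : 'M[R]_(m, n)) : 'M[R]_(n, m) :=
  xget 0 [set X | is_pinv A X]%classic.

(* Evaluation of a polynomial at a square matrix; mathcomp's [horner_mx]
   requires the size to be syntactically a successor, which 2 ^ k is not. *)
Definition poly_mx n (p : {poly R}) (X : 'M[R]_n) : 'M[R]_n :=
  \sum_(i < size p) p`_i *: X ^+ i.

Definition proj_const n : 'M[R]_n :=
  (dotv (ones n) (ones n))^-1 *: (ones n *m (ones n)^T).

(* Largest modulus of a complex eigenvalue; [sup] is over a finite set, nonempty
   if n > 0 (see [spectral_radius_has_sup]). *)
Definition eig_moduli n (M : 'M[R]_n) : set R :=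
  [set r : R | exists2 z : R[i],
     eigenvalue (map_mx (real_complex R) M) z & r = complex.Re `|z|]%classic.

Definition spectral_radius n (M : 'M[R]_n) : R := sup (eig_moduli M).

Lemma spectral_radius_has_sup n (M : 'M[R]_n) : (0 < n)%N ->
  has_sup (eig_moduli M).
Proof.
move=> n0; pose N := map_mx (real_complex R) M.
have [rs rsE] := closed_field_poly_normal (char_poly N).
have /monicP lc := char_poly_monic N.
rewrite lc scale1r in rsE.
have eigE z : eigenvalue N z = (z \in rs).
  by rewrite eigenvalue_root_char rsE root_prod_XsubC.
split.
  have : (0 < size rs)%N.
    have /eqP := size_char_poly N.
    by rewrite rsE size_prod_XsubC eqSS => /eqP ->.
  case: rs rsE eigE => // z rs _ eigE _.
  by exists (complex.Re `|z|), z => //; rewrite -/N eigE mem_head.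
have absz (z : R[i]) : 0 <= complex.Re `|z|.
  by rewrite normc_def /= sqrtr_ge0.
exists (\sum_(z <- rs) complex.Re `|z|) => r [z]; rewrite -/N eigE => zrs ->.
rewrite (big_rem z zrs) /= lerDl; apply: sumr_ge0 => w _; exact: absz.
Qed.

Lemma dotvE n (u v : 'cV[R]_n) : dotv u v = (u^T *m v) 0 0.
Proof. by rewrite /dotv mxE; apply: eq_bigr => i _; rewrite mxE. Qed.

Lemma dotvv_eq0 n (u : 'cV[R]_n) : dotv u u = 0 -> u = 0.
Proof.
move=> /eqP; rewrite /dotv psumr_eq0 => [|i _]; last by rewrite -expr2 sqr_ge0.
move=> /allP u0; apply/matrixP => i j; rewrite ord1 mxE.
by have := u0 i (mem_index_enum _); rewrite mulf_eq0 orbb => /eqP.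
Qed.

Lemma proj_constP n (u : 'cV[R]_n) : (0 < n)%N ->
  (exists a, proj_const n *m u = a *: ones n) /\
  dotv (u - proj_const n *m u) (ones n) = 0.
Proof.
move=> n0; set s := dotv (ones n) (ones n).
have s0 : s != 0.
  apply/eqP => /dotvv_eq0 /matrixP /(_ (Ordinal n0) 0) /eqP.
  by rewrite !mxE oner_eq0.
have E : proj_const n *m u = (s^-1 * dotv (ones n) u) *: ones n.
  rewrite /proj_const -/s -scalemxAl -mulmxA [_^T *m u]mx11_scalar -dotvE.
  by rewrite mul_mx_scalar scalerA.
split; first by exists (s^-1 * dotv (ones n) u).
have -> : proj_const n *m u = (s^-1 * dotv u (ones n)) *: ones n.
  by rewrite E; congr (_ * _ *: _); apply: eq_bigr => i _; rewrite mulrC.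
set a := s^-1 * _.
have -> : dotv (u - a *: ones n) (ones n) = dotv u (ones n) - a * s.
  rewrite /s /dotv mulr_sumr -sumrB.
  by apply: eq_bigr => i _; rewrite !mxE mulrBl mulrA.
by rewrite /a mulrAC mulVf // mul1r subrr.
Qed.

Lemma row_free_gram_unit r n (F : 'M[R]_(r, n)) :
  row_free F -> F *m F^T \in unitmx.
Proof.
move=> freeF; rewrite -row_free_unit -kermx_eq0.
apply/eqP/row_matrixP => i; rewrite row0.
have /sub_kermxP := row_sub i (kermx (F *m F^T)).
set u := row i _; rewrite mulmxA => uFF.
have uF0 : (u *m F)^T = 0.
  apply: dotvv_eq0.
  by rewrite dotvE trmxK trmx_mul mulmxA uFF mul0mx mxE.
apply: (row_free_inj freeF); rewrite mul0mx.
by apply: trmx_inj; rewrite uF0 trmx0.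
Qed.

Lemma is_pinv_uniq m n (A : 'M[R]_(m, n)) X Z :
  is_pinv A X -> is_pinv A Z -> X = Z.
Proof.
move=> [AXA XAX AXt XAt] [AZA ZAZ AZt ZAt].
have e1 : A *m X = A *m Z.
  by rewrite -[LHS]AXt -{1}AZA -mulmxA trmx_mul AXt AZt !mulmxA AXA.
have e2 : X *m A = Z *m A.
  by rewrite -[LHS]XAt -{1}AZA !mulmxA -mulmxA trmx_mul ZAt XAt -!mulmxA
     (mulmxA A) AXA.
by rewrite -XAX -mulmxA e1 mulmxA e2 ZAZ.
Qed.

Lemma is_pinv_full_rank m n r (C : 'M[R]_(m, r)) (F : 'M[R]_(r, n)) :
  row_free C^T -> row_free F ->
  is_pinv (C *m F)
    (F^T *m invmx (F *m F^T) *m (invmx (C^T *m C) *m C^T)).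
Proof.
move=> /row_free_gram_unit; rewrite trmxK => uC /row_free_gram_unit uF.
set X := (X in is_pinv _ X).
have AX : C *m F *m X = C *m (invmx (C^T *m C) *m C^T).
  by rewrite /X !mulmxA -(mulmxA C F) -(mulmxA C _ (invmx _)) mulmxV // mulmx1.
have XA : X *m (C *m F) = F^T *m invmx (F *m F^T) *m F.
  rewrite /X !mulmxA -(mulmxA _ C^T C) -(mulmxA _ (invmx (C^T *m C))).
  by rewrite mulVmx // mulmx1.
split.
- by rewrite AX !mulmxA -(mulmxA _ C^T C) -(mulmxA C) mulVmx // mulmx1.
- rewrite XA /X !mulmxA -(mulmxA _ F F^T) -(mulmxA _ (F *m F^T)).
  by rewrite mulmxV // mulmx1.
- by rewrite AX !trmx_mul trmxK trmx_inv trmx_mul trmxK mulmxA.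
- by rewrite XA !trmx_mul trmxK trmx_inv trmx_mul trmxK mulmxA.
Qed.

Lemma mp_pinvP m n (A : 'M[R]_(m, n)) : is_pinv A (mp_pinv A).
Proof.
have rC : row_free (col_base A)^T.
  by rewrite /row_free mxrank_tr; exact: col_base_full.
have := is_pinv_full_rank rC (row_base_free A).
by rewrite mulmx_base => pA; exact: xgetPex (ex_intro _ _ pA).
Qed.

End LinearAlgebra.

Section Graphs.

Definition simple_graph n (e : rel 'I_n) : Prop := symmetric e /\ irreflexive e.

Definition connected_graph n (e : rel 'I_n) : Prop := forall x y, connect e x y.

Definition in_edge n (i : 'I_n) (d : 'I_n * 'I_n) : bool :=
  (i == d.1) || (i == d.2).

(* [m] lists the edges of the matching, in any order and with any orientation
   (the orientation only affects the signs of the columns of [Ymx] below). *)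
Definition perfect_matching n p (e : rel 'I_n) (m : 'I_p -> 'I_n * 'I_n) : Prop :=
  (forall c, e (m c).1 (m c).2) /\ (forall i, exists! c, in_edge i (m c)).

Definition coarse_graph n p (e : rel 'I_n) (m : 'I_p -> 'I_n * 'I_n) : rel 'I_p :=
  fun c d => (c != d) &&
    [exists i, exists j, [&& in_edge i (m c), in_edge j (m d) & e i j]].

(* [G k] is the graph on 2 ^ k vertices for 1 <= k <= J, and [M k] lists the
   edges of the matching of the next finer graph [G k.+1] (M_(k+1) on paper), so
   that the c-th vertex of [G k] is the edge [M k c]. Values of [G] and [M] at
   other levels are irrelevant. *)
Definition matching_hierarchy (J : nat) (G : forall k, rel 'I_(2 ^ k))
    (M : forall k, 'I_(2 ^ k) -> 'I_(2 ^ k.+1) * 'I_(2 ^ k.+1)) : Prop :=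
  [/\ simple_graph (G J), connected_graph (G J) &
      forall k, (1 <= k < J)%N ->
        perfect_matching (G k.+1) (M k) /\ G k =2 coarse_graph (G k.+1) (M k)].

End Graphs.

Section Laplacian.
Variable R : realType.

(* An unordered edge is counted once, through its representative i < j. *)
Definition edge_form n (e : rel 'I_n) (u v : 'cV[R]_n) : R :=
  \sum_(i < n) \sum_(j < n | (i < j)%N && e i j) (u i 0 - u j 0) * (v i 0 - v j 0).

Definition laplacian n (e : rel 'I_n) : 'M[R]_n :=
  \matrix_(i, j) edge_form e (evec R i) (evec R j).

Lemma laplacianP n (e : rel 'I_n) (u v : 'cV[R]_n) :
  dotv (laplacian e *m u) v = edge_form e u v.
Proof.
have D (w : 'cV[R]_n) i : w i 0 = \sum_a evec R a i 0 * w a 0 :> R.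
  rewrite (bigD1 i) //= big1 => [|a ai]; rewrite !mxE !eqxx ?mul1r ?addr0 //.
  by rewrite eq_sym (negbTE ai) mul0r.
have Dsub (w : 'cV[R]_n) i j :
    w i 0 - w j 0 = \sum_a (evec R a i 0 - evec R a j 0) * w a 0 :> R.
  by rewrite [w i 0]D [w j 0]D -sumrB; apply: eq_bigr => a _; rewrite mulrBl.
have -> : edge_form e u v =
    \sum_a \sum_b edge_form e (evec R a) (evec R b) * u b 0 * v a 0.
  transitivity (\sum_(i < n) \sum_(j < n | (i < j)%N && e i j) \sum_a \sum_b
     (evec R a i 0 - evec R a j 0) * (evec R b i 0 - evec R b j 0)
       * u b 0 * v a 0).
    apply: eq_bigr => i _; apply: eq_bigr => j _.
    rewrite (Dsub u i j) (Dsub v i j) mulrC mulr_suml; apply: eq_bigr => a _.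
    rewrite mulr_sumr; apply: eq_bigr => b _.
    by rewrite mulrACA [v a 0 * _]mulrC mulrA.
  under eq_bigr do rewrite exchange_big /=.
  rewrite exchange_big /=; apply: eq_bigr => a _.
  under eq_bigr do rewrite exchange_big /=.
  rewrite exchange_big /=; apply: eq_bigr => b _.
  rewrite /edge_form !mulr_suml; apply: eq_bigr => i _.
  by rewrite !mulr_suml.
apply: eq_bigr => a _; rewrite !mxE mulr_suml.
by apply: eq_bigr => b _; rewrite mxE.
Qed.

End Laplacian.

Section TwoLevel.
Variables (R : realType) (n p : nat).
Variables (A : 'M[R]_n) (m : 'I_p -> 'I_n * 'I_n).

Definition Pmx : 'M[R]_(n, p) :=
  \matrix_(i, c) (evec R (m c).1 + evec R (m c).2) i 0.

Definition Ymx : 'M[R]_(n, p) :=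
  \matrix_(i, c) (evec R (m c).1 - evec R (m c).2) i 0.

Definition YPmx : 'M[R]_(n, p + p) := row_mx Ymx Pmx.

Definition YAY : 'M[R]_p := Ymx^T *m A *m Ymx.

Definition Ahat : 'M[R]_(p + p) := YPmx^T *m A *m YPmx.

Definition Lmx : 'M[R]_(p + p) :=
  block_mx 1%:M 0 (Pmx^T *m A *m Ymx *m invmx YAY) 1%:M.

Definition Ghat (sigma : R) (Ac : 'M[R]_p) : 'M[R]_(p + p) :=
  Lmx *m block_mx YAY 0 0 (sigma *: Ac) *m Lmx^T.

(* One step of the AMLI recursion: [Ac] and [Bc] are the coarse Laplacian and
   the coarse preconditioner. *)
Definition amli_hat (sigma : R) (q : {poly R}) (Ac Bc : 'M[R]_p) : 'M[R]_(p + p) :=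
  (invmx Lmx)^T
    *m block_mx (invmx YAY) 0 0 (sigma^-1 *: (Bc *m poly_mx q (Ac *m Bc)))
    *m invmx Lmx.

Definition amli_step (sigma : R) (q : {poly R}) (Ac Bc : 'M[R]_p) : 'M[R]_n :=
  YPmx *m amli_hat sigma q Ac Bc *m YPmx^T.

End TwoLevel.

Section AMLI.
Variable R : realType.

Definition qpoly (theta : R) : {poly R} :=
  (4 / (theta + 1)) *: (1 - (theta + 1)^-1 *: 'X).

(* The value at level 0 is junk. *)
Fixpoint theta (cg : R) (k : nat) : R :=
  match k with
  | 0 => 1
  | k'.+1 => if k' == 0%N then 1 else cg^-1 * (qpoly (theta cg k')).[1]
  end.

Variables (G : forall k, rel 'I_(2 ^ k)).
Variables (M : forall k, 'I_(2 ^ k) -> 'I_(2 ^ k.+1) * 'I_(2 ^ k.+1)).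

(* The matrix written B_k^{-1} on paper; the value at level 0 is junk. *)
Fixpoint Binv (sigma cg : R) (k : nat) : 'M[R]_(2 ^ k) :=
  match k with
  | 0 => 0
  | k'.+1 =>
      if k' == 0%N then mp_pinv (laplacian R (@G k'.+1))
      else amli_step (laplacian R (@G k'.+1)) (@M k') sigma
             (qpoly (theta cg k')) (laplacian R (@G k')) (Binv sigma cg k')
  end.

End AMLI.

(* Main.v *)
From Pilot Require Import Defs.
From HB Require Import structures.
From mathcomp Require Import all_boot all_order all_algebra.
From mathcomp Require Import boolp classical_sets reals exp.
From mathcomp Require Import complex ring lra.

Set Implicit Arguments.
Unset Strict Implicit.
Unset Printing Implicit Defensive.

Import Order.TTheory GRing.Theory Num.Theory.

Local Open Scope ring_scope.

(** Everything is expressed with inequalities between quadratic forms.  The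
    invariant carried from level to level is
    $$\theta_k (A_ku,u) \le (A_kB_k^{-1}A_ku,u) \le (A_ku,u),$$
    that is, the spectrum of $B_k^{-1}A_k$ modulo the constants lies in
    $[\theta_k,1]$ ([spectral_bounds]).

    It holds on the coarsest level with $\theta_1 = 1$ because
    $AA^\dagger A = A$.  To go from level $k$ to level $k+1$, two losses are
    measured.  The polynomial $q_k$ maps the spectrum into
    $\{tq_k(t) : t\in[\theta_k,1]\} = [q_k(1),1]$, since $tq_k(t)$ is a concave
    parabola of maximum $1$ that takes the same value $q_k(1)$ at both ends of
    the interval ([amli_poly_bounds]).  Replacing the Schur complement of
    $\widehat A_{k+1}$ by $\sigma A_k$ costs a factor between $1/c_g$ and $1$,
    by assumption ([spectral_bounds_dual]); the other block is inverted exactly.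
    Both facts combine after block elimination ([amli_step_bounds]) to the
    lower bound $q_k(1)/c_g = \theta_{k+1}$.  The
    elimination makes sense because all the graphs inherit connectedness from
    the finest one, so that the Laplacians vanish on constants only and
    $Y^TAY$ is invertible ([YAY_unit]).

    On the finest level, an eigenvector of the error propagator with a nonzero
    eigenvalue is orthogonal to the constants, hence in the range of $A$, and
    the invariant places its eigenvalue in $[0,1-\theta_J]$
    ([spectral_radius_le]).  Two lower bounds on $\theta_J$ finish the proof:
    the recursion started at $1$ stays above its fixed point
    $2/\sqrt{c_g}-1$ ([theta_ge_fixpoint]), and for $c_g\le 4$ the inverse
    $1/\theta_k$ grows by at most $2+\theta_k$ at each step, hence like
    $2k+\ln k$ ([theta_ge_log]). *)

Local Notation qpoly := Pilot.Defs.qpoly.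

(** * Quadratic forms and the Loewner order *)

Section QuadraticForms.
Variable R : realType.

Definition loewner n (A B : 'M[R]_n) : Prop :=
  forall u : 'cV[R]_n, dotv (A *m u) u <= dotv (B *m u) u.

Definition psd n (A : 'M[R]_n) : Prop :=
  A^T = A /\ forall u : 'cV[R]_n, 0 <= dotv (A *m u) u.

Lemma dotvC n (u v : 'cV[R]_n) : dotv u v = dotv v u.
Proof. by apply: eq_bigr => i _; rewrite mulrC. Qed.

Lemma dotvDl n (u v w : 'cV[R]_n) : dotv (u + v) w = dotv u w + dotv v w.
Proof. by rewrite -big_split; apply: eq_bigr => i _; rewrite mxE mulrDl. Qed.

Lemma dotvZl n a (u w : 'cV[R]_n) : dotv (a *: u) w = a * dotv u w.
Proof. by rewrite [RHS]mulr_sumr; apply: eq_bigr => i _; rewrite mxE mulrA. Qed.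

Lemma dotvBl n (u v w : 'cV[R]_n) : dotv (u - v) w = dotv u w - dotv v w.
Proof. by rewrite dotvDl -scaleN1r dotvZl mulN1r. Qed.

Lemma dotv0l n (w : 'cV[R]_n) : dotv 0 w = 0.
Proof. by rewrite -(scale0r w) dotvZl mul0r. Qed.

Lemma dotvv_ge0 n (u : 'cV[R]_n) : 0 <= dotv u u.
Proof. by apply: sumr_ge0 => i _; rewrite -expr2 sqr_ge0. Qed.

Lemma dotv_mul m n (A : 'M[R]_(m, n)) u v :
  dotv (A *m u) v = dotv u (A^T *m v).
Proof. by rewrite !dotvE trmx_mul mulmxA. Qed.

Lemma dotv_sym n (A : 'M[R]_n) u v :
  A^T = A -> dotv (A *m u) v = dotv u (A *m v).
Proof. by move=> sA; rewrite dotv_mul sA. Qed.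

Lemma dotv_congr m n (X : 'M[R]_(m, n)) (A : 'M[R]_m) u :
  dotv ((X^T *m A *m X) *m u) u = dotv (A *m (X *m u)) (X *m u).
Proof. by rewrite -!mulmxA dotv_mul trmxK. Qed.

Lemma loewner_congr m n (X : 'M[R]_(m, n)) (A B : 'M[R]_m) :
  loewner A B -> loewner (X^T *m A *m X) (X^T *m B *m X).
Proof. by move=> AB u; rewrite !dotv_congr. Qed.

Lemma trmx_congr m n (X : 'M[R]_(m, n)) (A : 'M[R]_m) :
  A^T = A -> (X^T *m A *m X)^T = X^T *m A *m X.
Proof. by move=> sA; rewrite !trmx_mul trmxK sA mulmxA. Qed.

Lemma dotv_sqrB n (A : 'M[R]_n) u v t : A^T = A ->
  dotv (A *m (u - t *: v)) (u - t *: v) =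
  dotv (A *m u) u - 2 * t * dotv (A *m u) v + t ^+ 2 * dotv (A *m v) v.
Proof.
move=> sA; rewrite mulmxBr -scalemxAr dotvBl dotvZl.
rewrite ![dotv _ (u - _)]dotvC !dotvBl !dotvZl.
rewrite (dotvC u (A *m v)) (dotv_sym _ _ sA) !(dotvC v) [dotv u (A *m u)]dotvC.
ring.
Qed.

(** The quadratic $t \mapsto (A(u - tAu), u - tAu)$ is nonnegative and vanishes
    at $t = 0$, so its linear coefficient $-2(Au, Au)$ must vanish as well. *)
Lemma psd_ker n (A : 'M[R]_n) u : psd A -> dotv (A *m u) u = 0 -> A *m u = 0.
Proof.
move=> [sA A0] Au0; apply: dotvv_eq0.
set a := dotv _ _; set v := A *m u.
have a0 : 0 <= a by exact: dotvv_ge0.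
set b := dotv (A *m v) v; have b0 : 0 <= b by exact: A0.
(* The optimal step a / b is replaced by a / (b + 1), as b may vanish. *)
have := A0 (u - (a / (b + 1)) *: v); rewrite dotv_sqrB // Au0 -/v -/a -/b.
have b1 : b + 1 != 0 by rewrite gt_eqF // ltr_wpDl.
have -> : 0 - 2 * (a / (b + 1)) * a + (a / (b + 1)) ^+ 2 * b =
  - (a / (b + 1)) ^+ 2 * (b + 2) by field.
move=> h; have : (a / (b + 1)) ^+ 2 <= 0.
  rewrite -(@pmulr_lle0 _ (b + 2)) ?ltr_wpDl //.
  by move: h; rewrite mulNr oppr_ge0.
by rewrite real_exprn_even_le0 ?num_real //= mulf_eq0 invr_eq0 (negbTE b1) orbF => /eqP.
Qed.

(** The kernels of $A = A^T$ and of $S^T$ are the orthogonal complements of the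
    ranges of $A$ and of $S$, so including the former reverses the inclusion
    of the latter. *)
Lemma range_incl_of_ker n m (A : 'M[R]_n) (S : 'M[R]_(n, m)) : A^T = A ->
  (forall z : 'cV[R]_n, A *m z = 0 -> S^T *m z = 0) -> exists D, S = A *m D.
Proof.
move=> sA kerAS; have : (S^T <= A)%MS.
  rewrite submxE; have := mulmx_coker A; move: (cokermx A) => K AK.
  apply/eqP/matrixP => i j; have := kerAS (col j K).
  rewrite colE !mulmxA AK mul0mx -colE => /(_ erefl) /matrixP /(_ i 0).
  by rewrite !mxE.
by case/submxP => D SD; exists D^T; rewrite -(trmxK S) SD trmx_mul sA.
Qed.

End QuadraticForms.

(** * Spectral bounds and the effect of the polynomial *)

Section SpectralEquivalence.
Variable R : realType.

(** When $A$ is positive semidefinite, this localizes the nonzero spectrum of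
    $BA$ in $[\theta,1]$; multiplying by $A$ on both sides keeps the condition
    meaningful for singular matrices and stable under congruence. *)
Definition spectral_bounds n (theta : R) (A B : 'M[R]_n) : Prop :=
  [/\ B^T = B, loewner (theta *: A) (A *m B *m A) & loewner (A *m B *m A) A].

Lemma poly_mx_widen n (p : {poly R}) (X : 'M[R]_n) d : (size p <= d)%N ->
  poly_mx p X = \sum_(i < d) p`_i *: X ^+ i.
Proof.
move=> pd; rewrite /poly_mx (big_ord_widen d (fun i => p`_i *: X ^+ i)) //.
rewrite big_mkcond; apply: eq_bigr => i _; case: ltnP => // pi.
by rewrite nth_default // scale0r.
Qed.

Lemma mul_qpoly_mx n (theta : R) (A B : 'M[R]_n) :
  B *m poly_mx (qpoly theta) (A *m B) =
  (4 / (theta + 1)) *: (B - (theta + 1)^-1 *: (B *m A *m B)).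
Proof.
have sz : (size (qpoly theta) <= 2)%N.
  apply: leq_trans (size_scale_leq _ _) _.
  rewrite (leq_trans (size_polyD _ _)) // geq_max size_poly1 size_polyN /=.
  by rewrite (leq_trans (size_scale_leq _ _)) // size_polyX.
rewrite (poly_mx_widen _ sz) big_ord_recr big_ord1 /= expr0 expr1.
have -> : (qpoly theta)`_0 = 4 / (theta + 1).
  by rewrite !(coefZ, coefB, coef1, coefX) !mulr0 subr0 mulr1.
have -> : (qpoly theta)`_1 = - (4 / (theta + 1) * (theta + 1)^-1).
  by rewrite !(coefZ, coefB, coef1, coefX) sub0r mulr1 mulrN.
rewrite mulmxDr -!scalemxAr mulmx1 scalerBr scaleNr scalerA.
by rewrite mulmxA.
Qed.

Lemma qpoly1 (theta : R) : theta + 1 != 0 ->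
  (qpoly theta).[1] = 4 * theta / (theta + 1) ^+ 2.
Proof. by move=> t1; rewrite /qpoly !hornerE; field. Qed.

(** With $X$ standing for $BA$, self-adjoint for the form $(A\cdot,\cdot)$ and of
    spectrum in $[\theta, 1]$, the bounds are those of $t q(t)$ on this interval.
    The upper one is $1 - Xq(X) = (1 - 2X/(\theta+1))^2$.  The lower one amounts to
    $(1 - X)(X - \theta) \ge 0$; to avoid a square root of $A$, this
    product of commuting nonnegative operators is multiplied by
    $1 - \theta = (1 - X) + (X - \theta)$, which turns it into
    $(X - \theta)(1 - X)(X - \theta) + (1 - X)(X - \theta)(1 - X)$.
    If $\theta = 1$, the form of $A(1 - X)$ vanishes identically, and so does
    the matrix. *)
Lemma amli_poly_bounds n (theta : R) (A B : 'M[R]_n) :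
  psd A -> 0 < theta <= 1 -> spectral_bounds theta A B ->
  spectral_bounds (qpoly theta).[1] A (B *m poly_mx (qpoly theta) (A *m B)).
Proof.
move=> psdA /andP[t0 t1] [sB lo up]; have [sA A0] := psdA.
have t10 : theta + 1 != 0 by rewrite gt_eqF // ltr_wpDl // ltW.
have sBAB : (B *m A *m B)^T = B *m A *m B by rewrite !trmx_mul sA sB mulmxA.
have sABA : (A *m B *m A)^T = A *m B *m A by rewrite !trmx_mul sA sB mulmxA.
rewrite mul_qpoly_mx qpoly1 //; set C := _ *: _.
have sC : C^T = C by rewrite /C linearZ linearB /= linearZ /= sBAB sB.
pose m1 u := dotv (A *m B *m A *m u) u.
pose m2 u := dotv (A *m (B *m A *m u)) (B *m A *m u).
have m1E u : dotv (A *m u) (B *m A *m u) = m1 u.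
  by rewrite dotv_sym // dotvC /m1 -!mulmxA.
have CE u : dotv (A *m C *m A *m u) u =
    4 / (theta + 1) * (m1 u - (theta + 1)^-1 * m2 u).
  rewrite /C -!(scalemxAr, scalemxAl) dotvZl mulmxBr !mulmxBl dotvBl.
  rewrite -!(scalemxAr, scalemxAl) dotvZl -/(m1 u); congr (_ * (_ - _ * _)).
  by rewrite /m2 -!mulmxA -[RHS](dotv_sym _ _ sB) -[RHS](dotv_sym _ _ sA).
split=> // u; rewrite CE; last first.
  rewrite -subr_ge0.
  have := A0 (u - (2 / (theta + 1)) *: (B *m A *m u)).
  rewrite dotv_sqrB // m1E -/(m2 u); congr (0 <= _); field; exact: t10.
rewrite -scalemxAl dotvZl; set m0 := dotv _ _.
have t12 : 0 < (theta + 1) ^+ 2 by rewrite exprn_gt0 // ltr_wpDl // ltW.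
(* The right-hand side is the form of (1 - X)(X - theta). *)
suff : 0 <= (theta + 1) * m1 u - m2 u - theta * m0.
  move=> h; rewrite -subr_ge0.
  have -> : 4 / (theta + 1) * (m1 u - (theta + 1)^-1 * m2 u) -
    4 * theta / (theta + 1) ^+ 2 * m0 =
    4 / (theta + 1) ^+ 2 * ((theta + 1) * m1 u - m2 u - theta * m0) by field.
  by rewrite mulr_ge0 // divr_ge0 // ltW.
set v := B *m A *m u; pose m3 := dotv (A *m B *m A *m v) v.
have m2E : dotv (A *m B *m A *m v) u = m2 u.
  by rewrite dotv_sym // dotvC /m2 /v -!mulmxA.
have D0 (x : 'cV_n) : 0 <= dotv ((A - A *m B *m A) *m x) x.
  by rewrite mulmxBl dotvBl subr_ge0.
have H0 (x : 'cV_n) : 0 <= dotv ((A *m B *m A - theta *: A) *m x) x.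
  by rewrite mulmxBl dotvBl subr_ge0.
have sD : (A - A *m B *m A)^T = A - A *m B *m A by rewrite linearB /= sABA sA.
have sH : (A *m B *m A - theta *: A)^T = A *m B *m A - theta *: A.
  by rewrite linearB linearZ /= sABA sA.
have Avu : dotv (A *m v) u = m1 u by rewrite dotv_sym // dotvC m1E.
have [theta1|tn1] := eqVneq theta 1.
  have Dx x : dotv ((A - A *m B *m A) *m x) x = 0.
    apply/le_anti; rewrite D0 andbT mulmxBl dotvBl subr_le0.
    by have := lo x; rewrite theta1 scale1r.
  have Du : (A - A *m B *m A) *m u = 0 by apply: psd_ker.
  have := congr1 (fun w => dotv w u) Du; have := congr1 (fun w => dotv w v) Du.
  rewrite !dotv0l mulmxBl !dotvBl m1E -/m0 -/(m1 u).
  have -> : dotv (A *m B *m A *m u) v = m2 u by rewrite -m2E dotv_sym // dotvC.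
  by move=> e1 e2; rewrite theta1; lra.
have tlt : 0 < 1 - theta by rewrite subr_gt0 lt_neqAle tn1.
rewrite -(pmulr_rge0 _ tlt).
have := addr_ge0 (D0 (v - theta *: u)) (H0 (u - 1 *: v)).
rewrite !dotv_sqrB // !mulmxBl -!scalemxAl !dotvBl !dotvZl m2E m1E Avu.
rewrite -/m0 -/(m1 u) -/(m2 u) -/m3.
have -> : dotv (A *m B *m A *m u) v = m2 u by rewrite -m2E dotv_sym // dotvC.
by congr (0 <= _); ring.
Qed.

End SpectralEquivalence.

(** * One step of the recursion *)

Section TwoLevelStep.
Variable R : realType.

(** Inverting an inequality between forms without pseudo-inverses: $Sw$ lies in
    the range of $A$, say $Sw = Az$, and then $(SCSw, w) = (ACAz, z)$ is
    controlled by $(Az, z)$.  Comparing $(Az, z)$ with $(Sw, w)$ amounts to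
    $\sigma^{-1}A^\dagger \le S^\dagger \le c\,\sigma^{-1}A^\dagger$; here it follows
    from expanding $(S(w - z/\sigma), w - z/\sigma) \ge 0$ and
    $(A(z - tw), z - tw) \ge 0$ with $t = \sigma/c$. *)
Lemma spectral_bounds_dual n (S A C : 'M[R]_n) (sigma c theta : R) :
  psd S -> psd A -> 0 < sigma -> 0 < c -> 0 <= theta ->
  loewner S (sigma *: A) -> loewner (sigma *: A) (c *: S) ->
  spectral_bounds theta A C ->
  spectral_bounds (theta / c) S (sigma^-1 *: C).
Proof.
move=> psdS psdA sg0 c0 t0 SA AS [sC lo up].
have [[sS S0] [sA A0]] := (psdS, psdA).
have [D SD] : exists D, S = A *m D.
  apply: range_incl_of_ker => // z Az0; rewrite sS; apply: psd_ker => //.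
  apply/le_anti; rewrite S0 andbT; apply: le_trans (SA z) _.
  by rewrite -scalemxAl Az0 scaler0 dotv0l.
have key w : exists2 z, A *m z = S *m w &
    dotv (S *m w) w / c <= sigma^-1 * dotv (A *m z) z <= dotv (S *m w) w.
  exists (D *m w); first by rewrite mulmxA -SD.
  set z := D *m w; have zw : A *m z = S *m w by rewrite mulmxA -SD.
  have := S0 (w - sigma^-1 *: z); have := A0 (z - (sigma / c) *: w).
  have Swz : dotv (S *m w) z = dotv (A *m z) z by rewrite zw.
  have Azw : dotv (A *m z) w = dotv (S *m w) w by rewrite zw.
  rewrite !dotv_sqrB // Swz Azw.
  have := SA z; have := AS w; rewrite -!scalemxAl !dotvZl.
  set x := dotv (S *m w) w; set y := dotv (A *m z) z.
  set x' := dotv (A *m w) w; set y' := dotv (S *m z) z => h1 h2 h3 h4.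
  apply/andP; split.
    have h5 : (sigma / c) ^+ 2 * x' <= sigma / c * x.
      rewrite expr2 -mulrA; apply: ler_wpM2l; first by rewrite divr_ge0 // ltW.
      rewrite mulrAC ler_pdivrMr //; lra.
    rewrite -(ler_pM2l sg0) mulVKf ?gt_eqF //.
    have -> : sigma * (x / c) = sigma / c * x by rewrite mulrA mulrAC.
    lra.
  have h5 : sigma^-1 ^+ 2 * y' <= sigma^-1 * y.
    rewrite expr2 -mulrA; apply: ler_wpM2l; first by rewrite invr_ge0 ltW.
    by rewrite ler_pdivrMl.
  lra.
have SCS w z : A *m z = S *m w ->
    dotv (S *m (sigma^-1 *: C) *m S *m w) w =
    sigma^-1 * dotv (A *m C *m A *m z) z.
  move=> zw; rewrite -scalemxAr -!scalemxAl dotvZl -!mulmxA.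
  by rewrite (dotv_sym _ _ sS) (dotv_sym _ _ sA) -zw.
split; first by rewrite linearZ /= sC.
- move=> w; have [z zw /andP[h1 h2]] := key w; rewrite (SCS _ _ zw).
  rewrite -scalemxAl dotvZl.
  have := lo z; rewrite -scalemxAl dotvZl => h3.
  apply: le_trans (_ : theta * (sigma^-1 * dotv (A *m z) z) <= _).
    by rewrite mulrAC -mulrA; apply: ler_wpM2l.
  by rewrite mulrCA; apply: ler_wpM2l; rewrite // invr_ge0 ltW.
- move=> w; have [z zw /andP[h1 h2]] := key w; rewrite (SCS _ _ zw).
  apply: le_trans h2; apply: ler_wpM2l; first by rewrite invr_ge0 ltW.
  exact: up.
Qed.

(** A right inverse $K'$ of $K$ lets $K'u$ represent an arbitrary $u$, so that
    bounds for the transformed form give bounds for the original one.  This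
    covers at once the change of basis $(Y,P)$ and the elimination by $L$. *)
Lemma spectral_bounds_congr m n (K : 'M[R]_(n, m)) (K' : 'M[R]_(m, n)) theta
    (A : 'M[R]_n) (X : 'M[R]_m) :
  K *m K' = 1%:M -> spectral_bounds theta (K^T *m A *m K) X ->
  spectral_bounds theta A (K *m X *m K^T).
Proof.
move=> KK' [sX lo up].
have E : K^T *m (A *m (K *m X *m K^T) *m A) *m K =
    K^T *m A *m K *m X *m (K^T *m A *m K) by rewrite !mulmxA.
have KK'u u : K *m (K' *m u) = u by rewrite mulmxA KK' mul1mx.
split; first by rewrite !trmx_mul trmxK sX mulmxA.
- move=> u; have := lo (K' *m u).
  by rewrite -E -!scalemxAl !dotvZl !dotv_congr KK'u.
- move=> u; have := up (K' *m u).
  by rewrite -E !dotv_congr KK'u.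
Qed.

Lemma dotv_col_mx m n (a c : 'cV[R]_m) (b d : 'cV[R]_n) :
  dotv (col_mx a b) (col_mx c d) = dotv a c + dotv b d.
Proof.
rewrite /dotv big_split_ord /=.
by congr (_ + _); apply: eq_bigr => i _; rewrite ?col_mxEu ?col_mxEd.
Qed.

Lemma dotv_block_diag m n (E : 'M[R]_m) (S : 'M[R]_n) a b :
  dotv (block_mx E 0 0 S *m col_mx a b) (col_mx a b) =
  dotv (E *m a) a + dotv (S *m b) b.
Proof. by rewrite mul_block_col !mul0mx addr0 add0r dotv_col_mx. Qed.

Lemma spectral_bounds_block_diag m n theta (E : 'M[R]_m) (S C : 'M[R]_n) :
  psd E -> E \in unitmx -> theta <= 1 -> spectral_bounds theta S C ->
  spectral_bounds theta (block_mx E 0 0 S) (block_mx (invmx E) 0 0 C).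
Proof.
move=> [sE E0] uE t1 [sC lo up].
have DE : block_mx E 0 0 S *m block_mx (invmx E) 0 0 C *m block_mx E 0 0 S =
    block_mx E 0 0 (S *m C *m S).
  rewrite !mulmx_block !(mulmx0, mul0mx, addr0, add0r).
  by rewrite mulmxV // mul1mx.
split; first by rewrite tr_block_mx !trmx0 trmx_inv sE sC.
- move=> u; rewrite DE -[u]vsubmxK -scalemxAl dotvZl !dotv_block_diag mulrDr.
  apply: lerD; first by rewrite ler_piMl.
  by have := lo (dsubmx u); rewrite -scalemxAl dotvZl.
- by move=> u; rewrite DE -[u]vsubmxK !dotv_block_diag lerD2l.
Qed.

Variables (n p : nat) (A : 'M[R]_n) (m : 'I_p -> 'I_n * 'I_n).

Let Y := Ymx R m.
Let P := Pmx R m.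
Let E := YAY A m.
Let F := P^T *m A *m Y *m invmx E.
Let L := Lmx A m.

(** The Schur complement of $Y^TAY$ in $\widehat A$. *)
Definition schur : 'M[R]_p := P^T *m A *m P - F *m (Y^T *m A *m P).

Lemma Lmx_unit : L \in unitmx.
Proof.
suff /mulmx1_unit[] : L *m block_mx 1%:M 0 (- F) 1%:M = 1%:M by [].
rewrite /L /Lmx -/E -/P -/Y -/F mulmx_block !(mulmx0, mul0mx, mulmx1, mul1mx).
by rewrite !addr0 add0r subrr -scalar_mx_block.
Qed.

Lemma Ahat_LDL : A^T = A -> E \in unitmx ->
  Ahat A m = L *m block_mx E 0 0 schur *m L^T.
Proof.
move=> sA uE.
have sE : E^T = E by exact: trmx_congr.
have FE : F *m E = P^T *m A *m Y by rewrite /F mulmxKV.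
have EF : E *m F^T = Y^T *m A *m P.
  by rewrite -[in LHS]sE -trmx_mul FE !trmx_mul trmxK sA mulmxA.
rewrite /Ahat /YPmx -/Y -/P tr_row_mx mul_col_mx mul_col_row.
rewrite /L /Lmx -/E -/P -/Y -/F tr_block_mx !trmx1 trmx0.
rewrite !mulmx_block !(mulmx0, mul0mx, mulmx1, mul1mx, addr0, add0r).
rewrite FE EF; congr block_mx.
by rewrite -FE -(mulmxA F E) EF /schur addrC subrK.
Qed.

Lemma loewner_Lcongr (X Z : 'M[R]_(p + p)) :
  loewner (L *m X *m L^T) (L *m Z *m L^T) -> loewner X Z.
Proof.
move=> XZ u; have := XZ ((invmx L)^T *m u).
have e (W : 'M[R]_(p + p)) : L *m W *m L^T = L^T^T *m W *m L^T by rewrite trmxK.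
have Lu : L^T *m ((invmx L)^T *m u) = u.
  by rewrite mulmxA -trmx_mul mulVmx ?Lmx_unit // trmx1 mul1mx.
by rewrite !e !dotv_congr Lu.
Qed.

(** Congruence by the unit triangular $L$ reduces everything to the block
    diagonal of $Y^TAY$ and the Schur complement $S$: on the first block the
    preconditioner is exact, on the second it is that of the coarse level,
    and the spectral equivalence of $\widehat A$ and $\widehat G$ is exactly
    that of $S$ and $\sigma A_c$. *)
Lemma amli_step_bounds (sigma c theta : R) (q : {poly R}) (Ac Bc : 'M[R]_p) :
  psd A -> psd Ac -> E \in unitmx -> YPmx R m *m (YPmx R m)^T = 2%:M ->
  0 < sigma -> 0 < c -> 0 <= theta <= c ->
  loewner (Ahat A m) (Ghat A m sigma Ac) ->
  loewner (Ghat A m sigma Ac) (c *: Ahat A m) ->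
  spectral_bounds theta Ac (Bc *m poly_mx q (Ac *m Bc)) ->
  spectral_bounds (theta / c) A (amli_step A m sigma q Ac Bc).
Proof.
move=> psdA psdAc uE NN sg0 c0 /andP[t0 tc] AG GA coarse.
have [sA A0] := psdA; have uL := Lmx_unit.
have psdE : psd E.
  by split; [exact: trmx_congr | move=> u; rewrite dotv_congr].
have AL := Ahat_LDL sA uE.
(* The basis change and the elimination, composed into one congruence. *)
pose N := YPmx R m; pose K := N *m (invmx L)^T.
have KAK : K^T *m A *m K = block_mx E 0 0 schur.
  have -> : K^T *m A *m K = invmx L *m Ahat A m *m (invmx L)^T.
    by rewrite /K /Ahat -/N trmx_mul trmxK !mulmxA.
  rewrite AL !mulmxA mulVmx // mul1mx -mulmxA -trmx_mul mulVmx //.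
  by rewrite trmx1 mulmx1.
have SG : loewner (block_mx E 0 0 schur) (block_mx E 0 0 (sigma *: Ac)).
  by apply: loewner_Lcongr; rewrite -AL.
have GS : loewner (block_mx E 0 0 (sigma *: Ac)) (c *: block_mx E 0 0 schur).
  by apply: loewner_Lcongr; rewrite -scalemxAr -scalemxAl -AL.
have at0 (X : 'M[R]_p) w : dotv (block_mx E 0 0 X *m col_mx 0 w) (col_mx 0 w) =
    dotv (X *m w) w by rewrite dotv_block_diag mulmx0 dotv0l add0r.
have psdS : psd schur.
  split; last by move=> w; rewrite -at0 -KAK dotv_congr.
  have := trmx_congr K sA; rewrite KAK tr_block_mx => /eq_block_mx[_ _ _].
  by [].
have SAc : loewner schur (sigma *: Ac).
  by move=> w; have := SG (col_mx 0 w); rewrite !at0.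
have AcS : loewner (sigma *: Ac) (c *: schur).
  move=> w; have := GS (col_mx 0 w).
  by rewrite -[(c *: block_mx _ _ _ _) *m _]scalemxAl dotvZl !at0
     -[(c *: schur) *m _]scalemxAl dotvZl.
rewrite /amli_step /amli_hat -/N -/L -/E.
have -> : N *m ((invmx L)^T *m block_mx (invmx E) 0 0
      (sigma^-1 *: (Bc *m poly_mx q (Ac *m Bc))) *m invmx L) *m N^T =
    K *m block_mx (invmx E) 0 0 (sigma^-1 *: (Bc *m poly_mx q (Ac *m Bc)))
      *m K^T by rewrite /K trmx_mul trmxK !mulmxA.
(* As N N^T = 2, a right inverse of K is L^T N^T / 2. *)
apply: (@spectral_bounds_congr _ _ _ (2^-1 *: (L^T *m N^T))).
  rewrite -scalemxAr /K !mulmxA -(mulmxA N) -trmx_mul mulmxV // trmx1 mulmx1.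
  by rewrite NN scale_scalar_mx mulVf // pnatr_eq0.
rewrite KAK; apply: spectral_bounds_block_diag => //.
  by rewrite ler_pdivrMr // mul1r.
exact: (spectral_bounds_dual psdS psdAc sg0 c0 t0 SAc AcS coarse).
Qed.

End TwoLevelStep.

(** * Laplacians, matchings and coarse graphs *)

Section Graphs.
Variable R : realType.

Lemma laplacian_psd n (e : rel 'I_n) : psd (laplacian R e).
Proof.
split.
  apply/matrixP => i j; rewrite !mxE; apply: eq_bigr => a _.
  by apply: eq_bigr => b _; rewrite mulrC.
move=> u; rewrite laplacianP; apply: sumr_ge0 => i _; apply: sumr_ge0 => j _.
by rewrite -expr2 sqr_ge0.
Qed.

Lemma laplacian_ones n (e : rel 'I_n) : laplacian R e *m ones R n = 0.
Proof.
apply: psd_ker; first exact: laplacian_psd.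
rewrite laplacianP /edge_form; apply: big1 => i _; apply: big1 => j _.
by rewrite !mxE subrr mul0r.
Qed.

(** A vanishing energy forces equal values along each edge, hence along each
    path. *)
Lemma laplacian_ker_const n (e : rel 'I_n) (u : 'cV[R]_n) :
  symmetric e -> connected_graph e -> dotv (laplacian R e *m u) u = 0 ->
  forall i j, u i 0 = u j 0.
Proof.
move=> se ce; rewrite laplacianP /edge_form => /eqP.
have sq0 i j : 0 <= (u i 0 - u j 0) * (u i 0 - u j 0).
  by rewrite -expr2 sqr_ge0.
rewrite psumr_eq0 => [/allP u0|i _]; last by apply: sumr_ge0.
have eu_lt (i j : 'I_n) : (i < j)%N -> e i j -> u i 0 = u j 0.
  move=> ij eij; have := u0 i (mem_index_enum _).
  rewrite /= psumr_eq0 // => /allP /(_ j (mem_index_enum _)).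
  by rewrite ij eij /= mulf_eq0 orbb subr_eq0 => /eqP.
have eu (i j : 'I_n) : e i j -> u i 0 = u j 0.
  have [ij|ij|/val_inj -> //] := ltngtP i j; first exact: eu_lt.
  by rewrite se => /eu_lt ->.
move=> i j; have /connectP[s] := ce i j.
elim: s i => [|k s IHs] i /= => [_ -> //|/andP[/eu -> pth lst]].
exact: IHs.
Qed.

Lemma unitmx_of_ker n (E : 'M[R]_n) :
  (forall x : 'cV_n, E *m x = 0 -> x = 0) -> E \in unitmx.
Proof.
move=> E0; rewrite -unitmx_tr -row_free_unit -kermx_eq0.
apply/eqP/row_matrixP => i; rewrite row0.
have /sub_kermxP := row_sub i (kermx E^T).
set w := row i _ => wE; apply: trmx_inj; rewrite trmx0; apply: E0.
by rewrite -[E]trmxK -trmx_mul wE trmx0.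
Qed.

Section Matching.
Variables (n p : nat) (e : rel 'I_n) (m : 'I_p -> 'I_n * 'I_n).
Hypotheses (irr_e : irreflexive e) (sym_e : symmetric e).
Hypothesis pm : perfect_matching e m.

Lemma matching_neq c : (m c).1 != (m c).2.
Proof.
by apply/eqP => E; have := pm.1 c; rewrite E irr_e.
Qed.

Lemma matching_uniq i c d : in_edge i (m c) -> in_edge i (m d) -> c = d.
Proof. by have [b [_ u]] := pm.2 i => /u <- /u. Qed.

(** The rows of $(Y,P)$ at the two ends of a matched edge are supported on the
    two columns of that edge, where they form an orthogonal basis of vectors
    of squared length 2. *)
Lemma YPmx_mul_tr : YPmx R m *m (YPmx R m)^T = 2%:M.
Proof.
rewrite /YPmx tr_row_mx mul_row_col; apply/matrixP => i j.
rewrite !mxE -big_split /=.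
under eq_bigr => c _.
  rewrite !mxE !andbT.
  have -> (a b c' d : R) : (a - b) * (c' - d) + (a + b) * (c' + d) =
    2 * (a * c' + b * d) by ring.
  over.
rewrite -mulr_sumr -[RHS]mulr_natr; congr (_ * _).
have [<-|ij] := eqVneq i j; last first.
  apply: big1 => c _; rewrite -!natrM !mulnb.
  have neq k : (i == k) && (j == k) = false.
    by apply/negbTE/negP => /andP[/eqP ik /eqP jk]; rewrite ik jk eqxx in ij.
  by rewrite !neq addr0.
have [c [ic u]] := pm.2 i; rewrite (bigD1 c) //= big1 => [|d dc].
  move: ic; rewrite /in_edge => /orP[]/eqP ->; rewrite ?(negbTE (matching_neq c)).
    by rewrite eqxx mulr1 mulr0 !addr0.
  by rewrite eq_sym (negbTE (matching_neq c)) eqxx mulr1 mulr0 add0r addr0.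
have : ~~ in_edge i (m d) by apply: contraNN dc => /u ->.
by rewrite /in_edge negb_or => /andP[/negbTE -> /negbTE ->]; rewrite mulr0 addr0.
Qed.

Lemma Ymx_mul_matched (x : 'cV[R]_p) c :
  (Ymx R m *m x) (m c).1 0 = x c 0 /\ (Ymx R m *m x) (m c).2 0 = - x c 0.
Proof.
have out i d : in_edge i (m c) -> d != c ->
    (i == (m d).1) = false /\ (i == (m d).2) = false.
  move=> ic dc; have : ~~ in_edge i (m d).
    by apply: contraNN dc => /(matching_uniq ic) ->.
  by rewrite /in_edge negb_or => /andP[/negbTE -> /negbTE ->].
have nc := negbTE (matching_neq c).
split; rewrite mxE (bigD1 c) //= big1 => [|d dc].
- by rewrite !mxE !eqxx nc subr0 mul1r addr0.
- have [|d1 d2] := out (m c).1 d _ dc; first by rewrite /in_edge eqxx.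
  by rewrite !mxE d1 d2 subr0 mul0r.
- by rewrite !mxE !eqxx eq_sym nc sub0r mulN1r addr0.
- have [|d1 d2] := out (m c).2 d _ dc; first by rewrite /in_edge eqxx orbT.
  by rewrite !mxE d1 d2 subr0 mul0r.
Qed.

(** A vector $Yx$ takes opposite values at the two ends of a matched edge, so it
    is constant only if it vanishes. *)
Lemma YAY_unit : connected_graph e -> YAY (laplacian R e) m \in unitmx.
Proof.
move=> ce; apply: unitmx_of_ker => x Ex0.
have /laplacian_ker_const Yx :
    dotv (laplacian R e *m (Ymx R m *m x)) (Ymx R m *m x) = 0.
  by rewrite -dotv_congr -/(YAY _ m) Ex0 dotv0l.
apply/matrixP => c k; rewrite ord1 mxE.
have [x1 x2] := Ymx_mul_matched x c.
have := Yx sym_e ce (m c).1 (m c).2; rewrite x1 x2; lra.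
Qed.

Lemma coarse_graph_simple : simple_graph (coarse_graph e m).
Proof.
split=> [c d|c]; last by rewrite /coarse_graph eqxx.
rewrite /coarse_graph eq_sym; congr (_ && _).
by apply/existsP/existsP => -[i /existsP[j /and3P[ic jd ij]]];
  exists j; apply/existsP; exists i; rewrite ic jd sym_e.
Qed.

(** Sending each vertex to its matched edge turns a path of the fine graph into
    a path of the coarse one, some steps of which may be stationary. *)
Lemma coarse_graph_connected :
  connected_graph e -> connected_graph (coarse_graph e m).
Proof.
move=> ce c d.
suff walk i j : connect e i j -> forall c d,
    in_edge i (m c) -> in_edge j (m d) -> connect (coarse_graph e m) c d.
  by apply: walk (ce (m c).1 (m d).1) _ _ _ _; rewrite /in_edge eqxx.
case/connectP=> s; elim: s i => [|k s IHs] i /= => [_ -> {c d}c d ic id|].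
  by rewrite (matching_uniq ic id) connect0.
case/andP=> ik pth lst {c d}c d ic jd.
have [b [kb _]] := pm.2 k.
apply: connect_trans (IHs k pth lst b d kb jd).
have [->|cb] := eqVneq c b; first exact: connect0.
apply: connect1; rewrite /coarse_graph cb.
by apply/existsP; exists i; apply/existsP; exists k; rewrite ic kb.
Qed.

End Matching.

End Graphs.

(** * From spectral bounds to the spectral radius *)

Section SpectralRadius.
Variable R : realType.

Local Notation toC := (real_complex R).

Lemma map_Re_mul m n (v : 'rV[R[i]]_m) (T : 'M[R]_(m, n)) :
  map_mx (@complex.Re R) (v *m map_mx toC T) = map_mx (@complex.Re R) v *m T.
Proof.
apply/matrixP => i j; rewrite !mxE raddf_sum /=; apply: eq_bigr => k _.
by rewrite !mxE; case: (v i k) => a b /=; rewrite mulr0 subr0.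
Qed.

Lemma map_Im_mul m n (v : 'rV[R[i]]_m) (T : 'M[R]_(m, n)) :
  map_mx (@complex.Im R) (v *m map_mx toC T) = map_mx (@complex.Im R) v *m T.
Proof.
apply/matrixP => i j; rewrite !mxE raddf_sum /=; apply: eq_bigr => k _.
by rewrite !mxE; case: (v i k) => a b /=; rewrite mulr0 add0r.
Qed.

Lemma map_Re_scale n (z : R[i]) (v : 'rV[R[i]]_n) :
  map_mx (@complex.Re R) (z *: v) =
  complex.Re z *: map_mx (@complex.Re R) v - complex.Im z *: map_mx (@complex.Im R) v.
Proof.
by apply/matrixP => i j; rewrite !mxE; case: z => a b; case: (v i j).
Qed.

Lemma map_Im_scale n (z : R[i]) (v : 'rV[R[i]]_n) :
  map_mx (@complex.Im R) (z *: v) =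
  complex.Re z *: map_mx (@complex.Im R) v + complex.Im z *: map_mx (@complex.Re R) v.
Proof.
by apply/matrixP => i j; rewrite !mxE; case: z => a b; case: (v i j).
Qed.

Lemma proj_const_ones n : (0 < n)%N -> proj_const R n *m ones R n = ones R n.
Proof.
move=> n0; rewrite /proj_const -scalemxAl -mulmxA.
rewrite [_^T *m _]mx11_scalar -dotvE mul_mx_scalar scalerA mulVf ?scale1r //.
apply/eqP => /dotvv_eq0 /matrixP /(_ (Ordinal n0) 0) /eqP.
by rewrite !mxE oner_eq0.
Qed.

(** Let $v$ be a left eigenvector of $T = (I-\Pi)(I-BA)$ for $z\ne0$.
    Since $T\mathbf 1 = 0$, it is orthogonal to the constants, so
    $v^T = Ag + iAh$ with real $g, h$, and the eigenvalue equation reads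
    $(A - ABA)(g+ih) = zA(g+ih)$.  Pairing it with $g$ and $h$ expresses $z$ as a
    quotient of the two real forms in the bounds; this shows first that
    $z$ is real, then that it lies in $[0,1-\theta]$. *)
Lemma spectral_radius_le n (A B : 'M[R]_n) (theta : R) : (0 < n)%N ->
  psd A -> A *m ones R n = 0 ->
  (forall u : 'cV_n, dotv (A *m u) u = 0 -> forall i j, u i 0 = u j 0) ->
  theta <= 1 -> spectral_bounds theta A B ->
  spectral_radius ((1%:M - proj_const R n) *m (1%:M - B *m A)) <= 1 - theta.
Proof.
move=> n0 psdA A1 kerA t1 [sB lo up]; have [sA A0] := psdA.
set T := _ *m _.
have T1 : T *m ones R n = 0.
  have BA1 : (1%:M - B *m A) *m ones R n = ones R n.
    by rewrite mulmxBl mul1mx -mulmxA A1 mulmx0 subr0.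
  rewrite /T -mulmxA BA1.
  by rewrite mulmxBl mul1mx proj_const_ones // subrr.
apply: ge_sup; first by have [] := spectral_radius_has_sup T n0.
move=> _ [z /eigenvalueP[v vT v0] ->].
have [->|z0] := eqVneq z 0; first by rewrite normr0 /= subr_ge0.
set a := complex.Re z; set b := complex.Im z.
rewrite normc_def /= -/a -/b.
set x := map_mx (@complex.Re R) v; set y := map_mx (@complex.Im R) v.
have xT : x *m T = a *: x - b *: y by rewrite -map_Re_mul vT map_Re_scale.
have yT : y *m T = a *: y + b *: x by rewrite -map_Im_mul vT map_Im_scale.
have ab0 : 0 < a ^+ 2 + b ^+ 2.
  rewrite lt_neqAle addr_ge0 ?sqr_ge0 // andbT eq_sym paddr_eq0 ?sqr_ge0 //.
  rewrite !sqrf_eq0; apply: contraNN z0 => /andP[/eqP a0 /eqP b0].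
  by apply/eqP; move: a0 b0; rewrite /a /b; case: (z) => ? ? /= -> ->.
have [x1 y1] : x *m ones R n = 0 /\ y *m ones R n = 0.
  have dot1 (w : 'rV_n) : (w *m ones R n = 0) <-> ((w *m ones R n) 0 0 = 0).
    by split=> [->|w1]; [rewrite mxE | rewrite (mx11_scalar (w *m _)) w1 raddf0].
  have := congr1 (fun w : 'rV_n => (w *m ones R n) 0 0) xT.
  have := congr1 (fun w : 'rV_n => (w *m ones R n) 0 0) yT.
  rewrite -!(mulmxA _ T) T1 !mulmx0 mulmxDl mulmxBl -!scalemxAl !dot1 !mxE.
  set s := \sum_i _; set t := \sum_i _ => e1 e2.
  split; apply: (mulfI (lt0r_neq0 ab0)); rewrite mulr0.
    transitivity (a * (a * t - b * s) + b * (a * s + b * t)); first by ring.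
    by rewrite -e1 -e2; ring.
  transitivity (a * (a * s + b * t) - b * (a * t - b * s)); first by ring.
  by rewrite -e1 -e2; ring.
have range (w : 'rV_n) : w *m ones R n = 0 -> exists g, w^T = A *m g.
  move=> w1; apply: range_incl_of_ker => // g Ag.
  have gc := kerA g; rewrite Ag dotv0l in gc.
  have -> : g = g (Ordinal n0) 0 *: ones R n.
    by apply/matrixP => i j; rewrite ord1 !mxE mulr1; exact: gc.
  by rewrite trmxK -scalemxAr w1 scaler0.
have act (w : 'rV_n) : w *m ones R n = 0 -> (w *m T)^T = w^T - A *m B *m w^T.
  move=> w1; have wP : w *m (1%:M - proj_const R n) = w.
    by rewrite mulmxBr mulmx1 -scalemxAr mulmxA w1 mul0mx scaler0 subr0.
  rewrite /T mulmxA wP mulmxBr mulmx1 linearB /= !trmx_mul.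
  by rewrite sA sB.
have [[g xg] [h yh]] := (range _ x1, range _ y1).
have := congr1 trmx xT; have := congr1 trmx yT.
rewrite !act // linearB linearD /= !linearZ /= xg yh scalerN !mulmxA => ey ex.
have := congr1 (fun w : 'cV_n => dotv w g) ex; have := congr1 (fun w => dotv w h) ey.
have := congr1 (fun w : 'cV_n => dotv w h) ex; have := congr1 (fun w => dotv w g) ey.
rewrite !dotvBl !dotvDl !dotvZl.
have sABA : (A *m B *m A)^T = A *m B *m A by rewrite !trmx_mul sA sB mulmxA.
have -> : dotv (A *m h) g = dotv (A *m g) h by rewrite dotv_sym // dotvC.
have -> : dotv (A *m B *m A *m h) g = dotv (A *m B *m A *m g) h.
  by rewrite dotv_sym // dotvC.
have := up g; have := up h; have := lo g; have := lo h.
have := A0 g; have := A0 h; rewrite -!scalemxAl !dotvZl.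
set al := dotv (A *m g) g; set be := dotv (A *m h) h.
set x11 := dotv _ g; set x22 := dotv _ h; set x12 := dotv _ h.
set ga := dotv _ h => be0 al0 loh log uph upg e1 e2 e3 e4.
(* If both energies vanish, the eigenvector is zero. *)
have s0 : 0 < al + be.
  rewrite lt_neqAle addr_ge0 // andbT eq_sym paddr_eq0 //.
  apply: contraNN v0 => /andP[/eqP al_0 /eqP be_0].
  have x0 : x = 0 by apply: trmx_inj; rewrite xg trmx0; exact: psd_ker.
  have y0 : y = 0 by apply: trmx_inj; rewrite yh trmx0; exact: psd_ker.
  apply/eqP/matrixP => i j; move/matrixP/(_ i j): x0; move/matrixP/(_ i j): y0.
  by rewrite !mxE; case: (v i j) => ? ? /= -> ->.
have b0 : b = 0.
  apply: (mulIf (lt0r_neq0 s0)); rewrite mul0r; lra.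
have a_def : (1 - a) * (al + be) = x11 + x22 by rewrite b0 in e3 e4; lra.
have a_lo : 0 <= a.
  by rewrite -(pmulr_lge0 _ s0); lra.
have a_up : a <= 1 - theta.
  by rewrite -(ler_pM2r s0); lra.
by rewrite b0 expr0n addr0 sqrtr_sqr ger0_norm.
Qed.

End SpectralRadius.

(** * The recursion for the lower bounds *)

Section ThetaRecursion.
Variable R : realType.

Lemma thetaS (cg : R) k :
  theta cg k.+2 = cg^-1 * (qpoly (theta cg k.+1)).[1].
Proof. by []. Qed.

Lemma qpoly1_in01 (t : R) : 0 < t <= 1 -> 0 < (qpoly t).[1] <= 1.
Proof.
move=> /andP[t0 t1].
have t10 : 0 < t + 1 by rewrite ltr_wpDl // ltW.
rewrite qpoly1 ?gt_eqF // divr_gt0 ?exprn_gt0 ?mulr_gt0 //=.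
rewrite ler_pdivrMr ?exprn_gt0 // mul1r -subr_ge0.
have -> : (t + 1) ^+ 2 - 4 * t = (t - 1) ^+ 2 by ring.
exact: sqr_ge0.
Qed.

Lemma theta_in01 (cg : R) k : 1 <= cg -> 0 < theta cg k.+1 <= 1.
Proof.
move=> cg1; elim: k => [|k IHk]; first by rewrite /= ltr01 lexx.
have cg0 : 0 < cg by apply: lt_le_trans cg1.
have /andP[q0 q1] := qpoly1_in01 IHk.
rewrite thetaS mulr_gt0 ?invr_gt0 //= ler_pdivrMl // mulr1.
exact: le_trans cg1.
Qed.

(** With $g = 2/\sqrt{c_g}$, the number $g - 1$ is the fixed point of the
    recursion, and $(y - g)((g - 1)y - g) \le 0$ for $y = \theta + 1 \in [g, 2]$
    says that a step cannot cross it. *)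
Lemma theta_ge_fixpoint (cg : R) k : 1 <= cg <= 4 ->
  2 / Num.sqrt cg - 1 <= theta cg k.+1.
Proof.
move=> /andP[cg1 cg4]; set s := Num.sqrt cg.
have cg0 : 0 <= cg by apply: le_trans cg1.
have sE : cg = s ^+ 2 by rewrite sqr_sqrtr.
have s1 : 1 <= s by rewrite -(sqrtr1 R) ler_wsqrtr.
have s2 : s <= 2.
  by rewrite -(@ler_pXn2r _ 2) ?nnegrE ?sqrtr_ge0 // -sE; lra.
have s0 : 0 < s by apply: lt_le_trans s1.
set g := 2 / s; have gs : g * s = 2 by rewrite /g divfK // gt_eqF.
have g2 : g <= 2 by rewrite /g ler_pdivrMr //; lra.
have g1 : 1 <= g by rewrite /g ler_pdivlMr //; lra.
elim: k => [|k IHk]; first by rewrite /=; lra.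
have /andP[t0 t1] := theta_in01 k cg1.
rewrite thetaS; move: (theta cg k.+1) t0 t1 IHk => t t0 t1 gt.
have t10 : 0 < t + 1 by lra.
rewrite qpoly1 ?gt_eqF // sE -exprVn.
have -> : s^-1 ^+ 2 * (4 * t / (t + 1) ^+ 2) = g ^+ 2 * t / (t + 1) ^+ 2.
  by rewrite /g; field; rewrite !gt_eqF.
rewrite ler_pdivlMr ?exprn_gt0 // -subr_ge0.
have -> : g ^+ 2 * t - (g - 1) * (t + 1) ^+ 2 =
  (t + 1 - g) * (g - (g - 1) * (t + 1)) by ring.
apply: mulr_ge0; first lra.
nra.
Qed.

(** This is $\ln(1+x)\le x$ at $x=-1/(n+1)$. *)
Lemma ln_step (n : R) : 1 <= n -> (n + 1)^-1 <= ln (n + 1) - ln n.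
Proof.
move=> n1; have n0 : 0 < n by lra.
have n10 : 0 < n + 1 by lra.
have := @le_ln1Dx R (- (n + 1)^-1).
rewrite ltrN2 invf_lt1 // ltrDr n0 => /(_ isT).
have -> : 1 - (n + 1)^-1 = n / (n + 1) by field; rewrite gt_eqF.
by rewrite ln_div ?posrE //; lra.
Qed.

(** As $c_g \le 4$, the inverses $x_k = 1/\theta_k$ satisfy
    $x_{k+1} \le x_k + 2 + 1/x_k$; once $2k + \ln k + 1$ is inserted for
    $x_k$, the last term is at most $1/(k+1) \le \ln(k+1) - \ln k$.  The
    insertion is legitimate because $x + 1/x$ is increasing for $x\ge1$. *)
Lemma theta_ge_log (cg : R) k : 1 <= cg <= 4 ->
  (2 * k.+1%:R + ln k.+1%:R + 1)^-1 <= theta cg k.+1.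
Proof.
move=> /andP[cg1 cg4].
elim: k => [|k IHk]; first by rewrite /= ln1 addr0 mulr1 invf_le1 ?addr_gt0 ?ltr0n ?lerDr.
have /andP[t0 t1] := theta_in01 k cg1.
rewrite thetaS; move: (theta cg k.+1) t0 t1 IHk => t t0 t1.
set n : R := k.+1%:R; have n1 : 1 <= n by rewrite /n ler1n.
have -> : k.+2%:R = n + 1 :> R by rewrite /n -natr1.
have := ln_step n1; set l' := ln (n + 1); set l := ln n => step.
have l0 : 0 <= l by rewrite ln_ge0.
set f := 2 * n + l + 1; have fn : n + 1 <= f by rewrite /f; lra.
have f0 : 0 < f by lra.
have t10 : 0 < t + 1 by lra.
have cg0 : 0 < cg by lra.
move=> ft; have ft1 : 1 <= f * t by rewrite -ler_pdivrMl // mulr1.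
have V : (n + 1)^-1 >= f^-1 by rewrite lef_pV2 ?posrE //; lra.
apply: (@le_trans _ _ (f + 2 + f^-1)^-1).
  have fV0 : 0 < f^-1 by rewrite invr_gt0.
  rewrite lef_pV2 ?posrE /f; lra.
rewrite qpoly1 ?gt_eqF //; apply: (@le_trans _ _ (t / (t + 1) ^+ 2)).
  have -> : (f + 2 + f^-1)^-1 = f / (f + 1) ^+ 2.
    by field; rewrite !gt_eqF //; nra.
  rewrite ler_pdivrMr ?exprn_gt0 //; last lra.
  rewrite mulrAC ler_pdivlMr ?exprn_gt0 // -subr_ge0.
  have -> : t * (f + 1) ^+ 2 - f * (t + 1) ^+ 2 = (f * t - 1) * (f - t) by ring.
  by apply: mulr_ge0; lra.
have -> : cg^-1 * (4 * t / (t + 1) ^+ 2) = 4 / cg * (t / (t + 1) ^+ 2).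
  by field; rewrite !gt_eqF.
apply: ler_peMl; first by rewrite divr_ge0 ?sqr_ge0 // ltW.
by rewrite ler_pdivlMr // mul1r.
Qed.

End ThetaRecursion.

(** * The multilevel hierarchy *)

Section Hierarchy.
Variable R : realType.

Lemma hierarchy_graphs (J : nat) (G : forall k : nat, rel 'I_(2 ^ k))
    (M : forall k : nat, 'I_(2 ^ k) -> 'I_(2 ^ k.+1) * 'I_(2 ^ k.+1)) k :
  matching_hierarchy J G M -> (1 <= k <= J)%N ->
  simple_graph (G k) /\ connected_graph (G k).
Proof.
move=> [sJ cJ step] /andP[k1 /subnKC].
move: (J - k)%N => d; elim: d k k1 => [|d IHd] k k1.
  by rewrite addn0 => ->; exact: conj sJ cJ.
rewrite addnS -addSn => kJ.
have kltJ : (1 <= k < J)%N by rewrite k1 -kJ addSn ltnS leq_addr.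
have [pm coarseE] := step k kltJ.
have [[se ie] ce] := IHd k.+1 (ltn0Sn k) kJ.
have -> : G k = coarse_graph (G k.+1) (M k).
  by apply/funext => c; apply/funext => d'; exact: coarseE.
exact: conj (coarse_graph_simple (M k) se) (coarse_graph_connected pm ce).
Qed.

Lemma mp_pinv_bounds n (A : 'M[R]_n) : A^T = A ->
  spectral_bounds 1 A (mp_pinv A).
Proof.
move=> sA; have pinvX := mp_pinvP A; move: (mp_pinv A) pinvX => X pinvX.
have [AXA XAX AXt XAt] := pinvX.
split; [|by move=> u; rewrite AXA scale1r|by move=> u; rewrite AXA].
apply: is_pinv_uniq pinvX.
have AXT : A *m X^T = X *m A by rewrite -[in RHS]XAt trmx_mul sA.
have XTA : X^T *m A = A *m X by rewrite -[in RHS]AXt trmx_mul sA.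
split.
- have := congr1 trmx AXA; by rewrite !trmx_mul sA mulmxA.
- by rewrite -[in RHS]XAX !trmx_mul sA mulmxA.
- by rewrite AXT XAt.
- by rewrite XTA AXt.
Qed.

(** By definition $\theta_{k+1}$ is the bound $q_k(1)$ left by the polynomial,
    divided by the constant $c_g$ lost in the change of coarse operator. *)
Lemma hierarchy_bounds (J : nat) (G : forall k : nat, rel 'I_(2 ^ k))
    (M : forall k : nat, 'I_(2 ^ k) -> 'I_(2 ^ k.+1) * 'I_(2 ^ k.+1))
    (sigma cg : R) :
  matching_hierarchy J G M -> 0 < sigma -> 1 <= cg ->
  (forall k : nat, (1 <= k < J)%N -> forall v : 'cV[R]_(2 ^ k + 2 ^ k),
     let Ah := Ahat (laplacian R (G k.+1)) (M k) in
     let Gh := Ghat (laplacian R (G k.+1)) (M k) sigma (laplacian R (G k)) in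
     dotv (Ah *m v) v <= dotv (Gh *m v) v <= cg * dotv (Ah *m v) v) ->
  forall k, (1 <= k <= J)%N ->
    spectral_bounds (theta cg k) (laplacian R (G k)) (Binv G M sigma cg k).
Proof.
move=> hG sg0 cg1 hspec; elim=> // -[|k] IHk kJ.
  by apply: mp_pinv_bounds; have [] := laplacian_psd R (G 1%N).
have k1J : (1 <= k.+1 < J)%N by exact: kJ.
have {IHk}IHk := IHk (ltnW k1J).
have [[symG irrG] conG] := hierarchy_graphs hG kJ.
have [pm _] : perfect_matching (G k.+2) (M k.+1) /\
    G k.+1 =2 coarse_graph (G k.+2) (M k.+1) by case: hG => _ _; exact.
have cg0 : 0 < cg by apply: lt_le_trans cg1.
have /andP[q0 q1] := qpoly1_in01 (theta_in01 k cg1).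
rewrite thetaS mulrC; apply: amli_step_bounds => //.
- exact: laplacian_psd.
- exact: laplacian_psd.
- exact: (YAY_unit R irrG symG pm conG).
- exact: (YPmx_mul_tr R irrG pm).
- by rewrite ltW //= (le_trans q1).
- by move=> v; have /andP[] := hspec _ k1J v.
- by move=> v; have /andP[_] := hspec _ k1J v; rewrite -scalemxAl dotvZl.
- by apply: amli_poly_bounds; [exact: laplacian_psd | exact: theta_in01 |].
Qed.

End Hierarchy.

Theorem theorem5p6 (R : realType) (J : nat)
  (G : forall k : nat, rel 'I_(2 ^ k))
  (M : forall k : nat, 'I_(2 ^ k) -> 'I_(2 ^ k.+1) * 'I_(2 ^ k.+1))
  (sigma cg : R)
  (hJ : (1 <= J)%N)
  (hG : matching_hierarchy J G M)
  (hsigma : 0 < sigma)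
  (hcg : 1 <= cg <= 4)
  (hspec : forall k : nat, (1 <= k < J)%N ->
     forall v : 'cV[R]_(2 ^ k + 2 ^ k),
       let Ah := Ahat (laplacian R (G k.+1)) (M k) in
       let Gh := Ghat (laplacian R (G k.+1)) (M k) sigma (laplacian R (G k)) in
       dotv (Ah *m v) v <= dotv (Gh *m v) v <= cg * dotv (Ah *m v) v) :
  spectral_radius
    ((1%:M - proj_const R (2 ^ J)) *m
       (1%:M - Binv G M sigma cg J *m laplacian R (G J)))
  <= Num.min ((2 * Num.sqrt cg - 2) / Num.sqrt cg)
       ((2 * J%:R + ln J%:R) / (2 * J%:R + ln J%:R + 1)) < 1.
Proof.
have J0 : 0 <= ln J%:R :> R by rewrite ln_ge0 // ler1n.
have f0 : 0 < 2 * J%:R + ln J%:R + 1 :> R.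
  by apply: ltr_wpDl => //; apply: addr_ge0 => //; apply: mulr_ge0.
have /andP[cg1 cg4] := hcg.
apply/andP; split; last first.
  apply: le_lt_trans (_ : (2 * J%:R + ln J%:R) / (2 * J%:R + ln J%:R + 1) < 1).
    by rewrite ge_min lexx orbT.
  by rewrite ltr_pdivrMr // mul1r ltrDl.
have [[symJ _] conJ] : simple_graph (G J) /\ connected_graph (G J).
  by case: hG.
have thetaJ : theta cg J <= 1 by case: (J) hJ => // k _; have /andP[] := theta_in01 k cg1.
have bounds : spectral_bounds (theta cg J) (laplacian R (G J)) (Binv G M sigma cg J).
  by apply: (hierarchy_bounds hG hsigma cg1 hspec); rewrite hJ leqnn.
apply: (@le_trans _ _ (1 - theta cg J)).
  apply: spectral_radius_le => //; first by rewrite expn_gt0.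
  - exact: laplacian_psd.
  - exact: laplacian_ones.
  - by move=> u; exact: laplacian_ker_const.
rewrite le_min; case: (J) hJ f0 => // k _ f0.
have s0 : 0 < Num.sqrt cg by rewrite sqrtr_gt0 (lt_le_trans ltr01).
have -> : (2 * Num.sqrt cg - 2) / Num.sqrt cg = 1 - (2 / Num.sqrt cg - 1).
  by field; rewrite gt_eqF.
have frac (a : R) : 0 < a + 1 -> a / (a + 1) = 1 - (a + 1)^-1.
  by move=> a1; field; rewrite gt_eqF.
rewrite (frac _ f0).
by rewrite !lerD2l !lerN2 theta_ge_fixpoint // theta_ge_log.
Qed.
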